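(* Let $K$ be a field. If $S=K[x_1,\dots,x_n]$ is a standard graded polynomial ring with $\dim(S)\le 2$ (that is, $n\le 2$), then $\mathrm{astab}(I)=1$ for any graded ideal $I\subset S$. Moreover, let $S=K[x,y]$ be the standard graded polynomial ring in two variables, let $b\ge 1$ be an integer, and let $I=(x^{2b+1},\,x^2y^{2b-1},\,y^{2b+1})\subset S$. Then: (a) $\mathrm{v}(I^k)=(2b+1)k$ for all integers $k$ with $1\le k\le b-1$; (b) $\mathrm{v}(I^k)=(2b+1)k-1$ for all integers $k\ge b$; (c) $(\mathrm{astab}(I),\mathrm{vstab}(I))=(1,b)$.
   Context: Let $S=K[x_1,\dots,x_n]$ be a polynomial ring over a field $K$ with the standard grading ($\deg x_i=1$), and let $I\subset S$ be a graded (homogeneous) ideal. $\mathrm{Ass}(I)$ denotes the set of associated primes of $I$, i.e. the prime ideals $\mathfrak p$ of the form $\mathfrak p=I:f$ for some $f\in S$ (the associated primes of the module $S/I$). By a theorem of Brodmann the sequence $\{\mathrm{Ass}(I^k)\}_{k\ge 1}$ is eventually constant. The index of ass-stability $\mathrm{astab}(I)$ is the least integer $k_0\ge 1$ such that $\mathrm{Ass}(I^k)=\mathrm{Ass}(I^{k_0})$ for all $k\ge k_0$. For $\mathfrak p\in\mathrm{Ass}(I)$, $\mathrm{v}_{\mathfrak p}(I)$ is the least degree of a homogeneous polynomial $f\in S$ with $I:f=\mathfrak p$, and the $\mathrm{v}$-number of $I$ is $\mathrm{v}(I)=\min_{\mathfrak p\in\mathrm{Ass}(I)}\mathrm{v}_{\mathfrak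 p}(I)$. Let $\alpha(I)=\min\{d: I_d\neq 0\}$ be the initial degree of $I$. It is known that there is an integer $c$ (depending on $I$) such that $\mathrm{v}(I^k)=\alpha(I)k+c$ for all sufficiently large $k$. The $\mathrm{v}$-stability index $\mathrm{vstab}(I)$ is the least integer $k_0\ge 1$ such that $\mathrm{v}(I^k)=\alpha(I)k+c$ for all $k\ge k_0$. *)

(* Defs.v *)
From mathcomp Require Import all_boot all_algebra.
From mathcomp Require Import mpoly.
From mathcomp Require Import classical_sets.

Set Implicit Arguments.
Unset Strict Implicit.
Unset Printing Implicit Defensive.

Import GRing.Theory.
Local Open Scope classical_set_scope.
Local Open Scope ring_scope.

(* Minima are rendered as relations, so that [is_least P m] also asserts that
   the minimum exists; no default value is involved. *)
Definition is_least (P : set nat) (m : nat) : Prop :=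
  P m /\ (forall k : nat, P k -> (m <= k)%N).

Section Ideals.
Variable R : comNzRingType.
Implicit Types (I J P A : set R).

(* MathComp's [idealr_closed] only covers proper ideals; the unit ideal is
   allowed here. *)
Definition is_ideal I : Prop :=
  I 0 /\ (forall a u v, I u -> I v -> I (a * u + v)).

Definition is_prime_ideal P : Prop :=
  [/\ is_ideal P, ~ P 1 & forall u v, P (u * v) -> P u \/ P v].

Definition ideal_gen A : set R := smallest is_ideal A.

Definition ideal_mul I J : set R := ideal_gen [set f * g | f in I & g in J].

Fixpoint ideal_exp I (k : nat) : set R :=
  if k is k'.+1 then ideal_mul I (ideal_exp I k') else setT.

Definition colon I (f : R) : set R := [set g | I (g * f)].

Definition Ass I : set (set R) :=
  [set P | is_prime_ideal P /\ exists f, colon I f = P].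

Definition is_astab I (k0 : nat) : Prop :=
  is_least [set j | (1 <= j)%N /\
    forall k, (j <= k)%N -> Ass (ideal_exp I k) = Ass (ideal_exp I j)] k0.

End Ideals.

Section Graded.
Variables (K : fieldType) (n : nat).
Implicit Types (I P : set {mpoly K[n]}).

Definition is_graded_ideal I : Prop :=
  is_ideal I /\
  (forall f, I f -> forall d : nat, I (pihomog mdeg d f)).

Definition is_initial_degree I (a : nat) : Prop :=
  is_least [set d | exists f, [/\ I f, f \is d.-homog & f != 0]] a.

(* The zero polynomial is [d.-homog] for every d, but cannot occur below when
   P is prime, since [colon I 0] is the unit ideal. *)
Definition is_vnumber_at I P (m : nat) : Prop :=
  is_least [set d | exists2 f, f \is d.-homog & colon I f = P] m.

Definition is_vnumber I (m : nat) : Prop :=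
  is_least [set d | exists2 P, Ass I P & is_vnumber_at I P d] m.

Definition vnumber_linear_from I (a : nat) (c : int) (k0 : nat) : Prop :=
  forall k, (k0 <= k)%N ->
    exists2 m : nat, is_vnumber (ideal_exp I k) m & m%:Z = a%:Z * k%:Z + c.

(* The constant c is determined by the values of the v-number for large k. *)
Definition is_vstab I (k0 : nat) : Prop :=
  exists (a : nat) (c : int), is_initial_degree I a /\
    is_least [set j | (1 <= j)%N /\ vnumber_linear_from I a c j] k0.

End Graded.

(* Main.v *)
(* A nonzero graded ideal I in at most two variables is g J, where g is the gcd
   of I and J is the unit ideal or contains powers of all variables (in two
   variables, g is found by dehomogenizing to K[t]).  Since I^k = g^k J^k, a
   prime P not containing J is associated to I^k iff it is associated to (g^k),
   iff it is associated to (g), whatever k is; and a prime containing J is the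
   maximal ideal (x, y), associated to every I^k because J^k has a socle.

   For the monomial ideal I = (x^(2b+1), x^2 y^(2b-1), y^(2b+1)), v(I^k) is the
   least degree of a monomial x^a y^c outside I^k with x^(a+1) y^c and
   x^a y^(c+1) in I^k.  As I^k is generated in degree (2b+1)k, this is at least
   (2b+1)k - 1, with equality iff two consecutive integers are of the form
   (2b+1)i + 2j with i + j <= k: for k >= b take 2b and 2b+1, and for k < b a
   parity and size argument excludes it.  In all cases x y^((2b+1)k - 1) is a
   socle monomial of degree (2b+1)k. *)

Require Import Defs.
From mathcomp Require Import all_boot all_algebra.
From mathcomp Require Import mpoly.
From mathcomp Require Import boolp classical_sets.
From mathcomp Require Import ring zify.

Set Implicit Arguments.
Unset Strict Implicit.
Unset Printing Implicit Defensive.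

Import GRing.Theory.
Local Open Scope classical_set_scope.
Local Open Scope ring_scope.

(** * Ideals and associated primes *)

Lemma ideal_mulr (R : comNzRingType) (I : set R) (a u : R) :
  is_ideal I -> I u -> I (a * u).
Proof. by case=> I0 IM Iu; rewrite -[_ * _]addr0; apply: IM. Qed.

Lemma ideal_mull (R : comNzRingType) (I : set R) (a u : R) :
  is_ideal I -> I u -> I (u * a).
Proof. by rewrite mulrC; apply: ideal_mulr. Qed.

Lemma ideal_add (R : comNzRingType) (I : set R) (u v : R) :
  is_ideal I -> I u -> I v -> I (u + v).
Proof. by case=> I0 IM Iu Iv; rewrite -[u]mul1r; apply: IM. Qed.

Lemma ideal_opp (R : comNzRingType) (I : set R) (u : R) :
  is_ideal I -> I u -> I (- u).
Proof. by move=> iI Iu; rewrite -mulN1r; apply: ideal_mulr. Qed.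

Lemma ideal_sum (R : comNzRingType) (I : set R) (T : Type) (r : seq T)
    (F : T -> R) :
  is_ideal I -> (forall i, I (F i)) -> I (\sum_(i <- r) F i).
Proof.
move=> iI IF; apply: (big_ind I) => [|u v|i _]; [by case: iI| |exact: IF].
exact: ideal_add.
Qed.

Lemma ideal_dvd_pow (R : comNzRingType) (I : set R) (u : R) (m n : nat) :
  is_ideal I -> (m <= n)%N -> I (u ^+ m) -> I (u ^+ n).
Proof. by move=> iI le_mn; rewrite -(subnK le_mn) exprD; apply: ideal_mulr. Qed.

Lemma ideal_setT (R : comNzRingType) : is_ideal (setT : set R).
Proof. by []. Qed.

Lemma ideal_gen_ideal (R : comNzRingType) (A : set R) : is_ideal (ideal_gen A).
Proof.
split=> [|a u v Au Av] J [iJ AJ]; first by case: iJ.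
by case: (iJ) => _; apply; [apply: Au|apply: Av].
Qed.

Lemma ideal_exp_ideal (R : comNzRingType) (I : set R) (k : nat) :
  is_ideal (ideal_exp I k).
Proof. case: k => [|k]; [exact: ideal_setT | exact: ideal_gen_ideal]. Qed.

Lemma mem_ideal_mul (R : comNzRingType) (I J : set R) (u v : R) :
  I u -> J v -> ideal_mul I J (u * v).
Proof. by move=> Iu Jv; apply: sub_gen_smallest; exists u => //; exists v. Qed.

Lemma ideal_mul_sub (R : comNzRingType) (I J L : set R) :
  is_ideal L -> (forall u v, I u -> J v -> L (u * v)) -> ideal_mul I J `<=` L.
Proof.
move=> iL IJL; apply: smallest_sub => // _ [u Iu [v Jv <-]]; exact: IJL.
Qed.

Lemma ideal_exp_expr (R : comNzRingType) (I : set R) (u : R) (k : nat) :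
  I u -> ideal_exp I k (u ^+ k).
Proof. by move=> Iu; elim: k => // k IHk; rewrite exprS; apply: mem_ideal_mul. Qed.

Lemma ideal_exp_sub (R : comNzRingType) (I : set R) (k : nat) :
  is_ideal I -> (0 < k)%N -> ideal_exp I k `<=` I.
Proof.
case: k => // k iI _; apply: ideal_mul_sub => // u v Iu _; exact: ideal_mull.
Qed.

Lemma ideal_exp1 (R : comNzRingType) (I : set R) :
  is_ideal I -> ideal_exp I 1 = I.
Proof.
move=> iI; apply/seteqP; split; first exact: ideal_exp_sub.
by move=> u Iu; rewrite -[u]mulr1; apply: mem_ideal_mul.
Qed.

Lemma ideal_scale (R : comNzRingType) (g : R) (J : set R) :
  is_ideal J -> is_ideal ( *%R g @` J).
Proof.
move=> iJ; split; first by exists 0; rewrite ?mulr0 //; case: iJ.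
move=> a _ _ [u Ju <-] [v Jv <-]; exists (a * u + v); last by ring.
by case: iJ => _; apply.
Qed.

Lemma ideal_quot (R : comNzRingType) (g : R) (I : set R) :
  is_ideal I -> is_ideal [set u | I (g * u)].
Proof.
move=> iI; split=> [|a u v] /=; first by rewrite mulr0; case: iI.
move=> Iu Iv; have -> : g * (a * u + v) = a * (g * u) + g * v by ring.
by case: iI => _; apply.
Qed.

Lemma colon_ideal (R : comNzRingType) (I : set R) (f : R) :
  is_ideal I -> is_ideal (colon I f).
Proof.
move=> iI; have -> : colon I f = [set u | I (f * u)].
  by apply/seteqP; split=> u; rewrite /colon /= mulrC.
exact: ideal_quot.
Qed.

Lemma ideal_expD (R : comNzRingType) (I : set R) (i j : nat) (u v : R) :
  ideal_exp I i u -> ideal_exp I j v -> ideal_exp I (i + j) (u * v).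
Proof.
move=> Iu Jv; elim: i u Iu => [|i IHi] u Iu.
  by apply: ideal_mulr => //; apply: ideal_exp_ideal.
move: u Iu; apply: (@ideal_mul_sub _ I (ideal_exp I i)
  [set u | ideal_exp I (i.+1 + j) (u * v)]).
  by apply: colon_ideal; apply: ideal_exp_ideal.
move=> s t Is It; rewrite /= -mulrA; apply: mem_ideal_mul => //; exact: IHi.
Qed.

Lemma ideal_exp_scale (R : comNzRingType) (g : R) (J : set R) (k : nat) :
  ideal_exp ( *%R g @` J) k = *%R (g ^+ k) @` ideal_exp J k.
Proof.
elim: k => [|k IHk]; apply/seteqP; split.
- by move=> u _; exists u; rewrite // mul1r.
- by [].
- apply: (@ideal_mul_sub _ _ (ideal_exp ( *%R g @` J) k)).
    exact/ideal_scale/ideal_exp_ideal.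
  rewrite IHk => _ _ [u Ju <-] [v Jv <-]; exists (u * v).
    exact: mem_ideal_mul.
  by rewrite exprS; ring.
- move=> _ [u Ju <-]; move: u Ju.
  apply: (@ideal_mul_sub R J (ideal_exp J k)
    [set u | ideal_exp ( *%R g @` J) k.+1 (g ^+ k.+1 * u)]).
    exact/ideal_quot/ideal_exp_ideal.
  move=> u v Ju Jv /=.
  have -> : g ^+ k.+1 * (u * v) = (g * u) * (g ^+ k * v) by rewrite exprS; ring.
  by apply: mem_ideal_mul; [exists u | rewrite IHk; exists v].
Qed.

Lemma prime_expr (R : comNzRingType) (P : set R) (u : R) (k : nat) :
  is_prime_ideal P -> P (u ^+ k) -> P u.
Proof.
move=> [_ P1 PM]; elim: k => [//|k IHk].
by rewrite exprS => /PM[].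
Qed.

Lemma prime_cancel (R : comNzRingType) (P : set R) (u v : R) :
  is_prime_ideal P -> ~ P v -> P (u * v) -> P u.
Proof. by move=> [_ _ PM] nPv /PM[]. Qed.

Lemma prime_ideal_exp_sub (R : comNzRingType) (P J : set R) (k : nat) :
  is_prime_ideal P -> ideal_exp J k `<=` P -> J `<=` P.
Proof.
by move=> pP JP u Ju; apply: (@prime_expr R P u k) => //; apply/JP/ideal_exp_expr.
Qed.

Lemma colon_sub (R : comNzRingType) (I : set R) (f : R) :
  is_ideal I -> I `<=` colon I f.
Proof. by move=> iI u Iu; apply: ideal_mull. Qed.

Lemma Ass_sub (R : comNzRingType) (I P : set R) : is_ideal I -> Ass I P -> I `<=` P.
Proof. by move=> iI [_ [f <-]]; apply: colon_sub. Qed.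

(** Take u in J outside P. A witness f for gJ also serves for (g), because the extra factor u can be
    cancelled modulo P; a witness f for (g) becomes the witness u f for gJ. *)
Lemma Ass_scale (R : idomainType) (g : R) (J P : set R) :
  is_ideal J -> ~ J `<=` P ->
  Ass ( *%R g @` J) P <-> Ass ( *%R g @` setT) P.
Proof.
move=> iJ /existsNP[u /not_implyP[Ju nPu]]; split=> -[pP [f fP]]; split=> //.
- exists f; apply/seteqP; split=> h.
    move=> [w _ gw]; apply: (prime_cancel pP nPu); rewrite -fP.
    by exists (w * u); [exact: ideal_mulr|rewrite mulrA gw mulrAC].
  by rewrite -{1}fP => -[w _ gw]; exists w.
- exists (u * f); apply/seteqP; split=> h.
    move=> [w _ gw]; apply: (prime_cancel pP nPu); rewrite -fP.
    by exists w => //; rewrite gw mulrA.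
  rewrite -{1}fP => -[w _ gw]; exists (u * w); first exact: ideal_mull.
  by rewrite (mulrCA h) -gw; ring.
Qed.

(* For the direct implication, a prime (g^k : f) is either already (g : f), or
   some c outside P makes c f = g f', and then P = (g^(k-1) : f'). *)
Lemma Ass_principal_expr (R : idomainType) (g : R) (P : set R) (k : nat) :
  g != 0 -> (0 < k)%N ->
  Ass ( *%R (g ^+ k) @` setT) P <-> Ass ( *%R g @` setT) P.
Proof.
case: k => // k g0 _; split=> -[pP [f fP]].
- elim: k f fP => [|k IHk] f fP; first by split=> //; exists f.
  have [[c [nPc [f' _ gf']]]|nc] :=
      pselect (exists c, ~ P c /\ ( *%R g @` setT) (c * f)).
    apply: (IHk f'); apply/seteqP; split=> h.
      move=> [w _ gw]; apply: (prime_cancel pP nPc); rewrite -fP.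
      by exists w => //; rewrite exprS -mulrA gw -[RHS]mulrA -gf' mulrCA.
    rewrite -{1}fP => -[w _ gw]; exists (c * w) => //; apply: (mulfI g0).
    rewrite (_ : g * (h * f') = h * (g * f')); last by ring.
    by rewrite gf' [RHS]mulrCA -gw (exprS g k.+1); ring.
  split=> //; exists f; apply/seteqP; split=> h.
    by move=> hf; apply: contrapT => nPh; apply: nc; exists h.
  by rewrite -{1}fP => -[w _ gw]; exists (g ^+ k.+1 * w); rewrite // mulrA -exprS.
- split=> //; exists (g ^+ k * f); rewrite -fP; apply/seteqP; split=> h.
    move=> [w _ gw]; exists w => //; apply: (mulfI (expf_neq0 k g0)).
    by rewrite mulrA -exprSr gw; ring.
  by move=> [w _ gw]; exists w => //; rewrite (mulrCA h) -gw exprSr mulrA.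
Qed.

Lemma last_power_outside (R : comNzRingType) (J : set R) (x f : R) (n : nat) :
  is_ideal J -> ~ J f -> J (x ^+ n) ->
  exists m, ~ J (x ^+ m * f) /\ J (x * (x ^+ m * f)).
Proof.
move=> iJ nJf Jx; have ex : exists m, `[< J (x ^+ m * f) >].
  by exists n; apply/asboolP; apply: ideal_mull.
case: (ex_minnP ex) => -[|m] /asboolP Jm min_m; first by case: nJf; rewrite -[f]mul1r.
exists m; split; last by rewrite mulrA -exprS.
by move=> /asboolT /min_m; rewrite ltnn.
Qed.

(** Multiply 1 by the last power of x that keeps it outside J, then by the last such power of y. The
    product h is outside J while x h and y h lie in J, so J : h is proper and contains x and y. *)
Lemma Ass_socle (R : comNzRingType) (J M : set R) (x y : R) (n : nat) :
  is_ideal J -> ~ J 1 -> J (x ^+ n) -> J (y ^+ n) -> is_prime_ideal M ->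
  (forall P, is_ideal P -> ~ P 1 -> P x -> P y -> P = M) -> Ass J M.
Proof.
move=> iJ nJ1 Jx Jy pM uniqM.
have [a []] := last_power_outside iJ nJ1 Jx; set f := x ^+ a * 1 => nJf Jxf.
have [b []] := last_power_outside iJ nJf Jy; set h := y ^+ b * f => nJh Jyh.
split=> //; exists h; apply: uniqM => //; first exact: colon_ideal.
  by rewrite /colon /= mul1r.
by rewrite /colon /= mulrCA; apply: ideal_mulr.
Qed.

(* The second alternative says that J is primary to a maximal ideal M = (x, y):
   no proper ideal other than M contains both x and y. *)
Definition unit_or_primary (R : comNzRingType) (J : set R) : Prop :=
  J 1 \/ exists M x y n, [/\ is_prime_ideal M,
    forall P, is_ideal P -> ~ P 1 -> P x -> P y -> P = M,
    J (x ^+ n) & J (y ^+ n)].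

Lemma Ass_exp_scale (R : idomainType) (g : R) (J : set R) (k : nat) :
  g != 0 -> is_ideal J -> unit_or_primary J -> (0 < k)%N ->
  Ass (ideal_exp ( *%R g @` J) k) = Ass ( *%R g @` J).
Proof.
move=> g0 iJ cJ k0; rewrite ideal_exp_scale.
have iJk := ideal_exp_ideal J k.
have gk0 : g ^+ k != 0 by apply: expf_neq0.
(* Primes containing J are handled for every exponent j at once, since both j = k and j = 1 are
   needed. *)
suff AssM (P : set R) : is_prime_ideal P -> J `<=` P ->
    forall j, (0 < j)%N -> Ass ( *%R (g ^+ j) @` ideal_exp J j) P.
  apply/predeqP => P.
  have [pP|npP] := pselect (is_prime_ideal P); last by split=> -[].
  have [JP|nJP] := pselect (J `<=` P).
    split=> _; last exact: AssM.
    by have := AssM P pP JP 1 isT; rewrite ideal_exp1.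
  have nJkP : ~ ideal_exp J k `<=` P by move/(prime_ideal_exp_sub pP).
  rewrite (Ass_scale _ iJk nJkP) (Ass_scale _ iJ nJP).
  exact: Ass_principal_expr.
move=> pP JP j j0; case: cJ => [J1|[M [x [y [n [pM uM Jx Jy]]]]]].
  by case: pP => _ []; apply: JP.
have [iP P1 PM] := pP.
have PE : P = M.
  by apply: uM => //; apply: (@prime_expr R P _ n) => //; apply: JP.
have [_ [f fM]] : Ass (ideal_exp J j) M.
  apply: (@Ass_socle _ _ M x y (n * j)) => //; rewrite ?exprM.
  - exact: ideal_exp_ideal.
  - by move/(ideal_exp_sub iJ j0)/JP.
  - exact: ideal_exp_expr.
  - exact: ideal_exp_expr.
(* Since g^j cancels in a domain, g^j f has the same colon with respect to g^j J^j as f has with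
   respect to J^j. *)
split=> //; exists (g ^+ j * f); rewrite PE -fM; apply/seteqP; split=> h.
  move=> [u Ju gu]; rewrite /colon /= -(_ : u = h * f) //.
  by apply: (mulfI (expf_neq0 j g0)); rewrite gu mulrCA.
by move=> Jhf; exists (h * f); rewrite // mulrCA.
Qed.

(** * Graded ideals in at most two variables *)

Lemma mcoeff_pihomog (n : nat) (R : comNzRingType) (d : nat) (p : {mpoly R[n]})
    (m : 'X_{1..n}) :
  (pihomog mdeg d p)@_m = if mdeg m == d then p@_m else 0.
Proof.
rewrite pihomogE linear_sum /=; case: (eqVneq (mdeg m) d) => [md|nmd].
  rewrite [in RHS](mpolyE p) linear_sum /= big_mkcond /=.
  apply: eq_bigr => i _; case: ifPn => // nid.
  rewrite linearZ /= mcoeffX; case: (i =P m) nid => [->|_ _]; last by rewrite mulr0.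
  by rewrite md eqxx.
rewrite big1 // => i /eqP id; rewrite linearZ /= mcoeffX.
by case: (i =P m) nmd => [<-|_ _]; rewrite ?id ?eqxx // mulr0.
Qed.

Lemma pihomog_mull (n : nat) (R : comNzRingType) (d e : nat)
    (g f : {mpoly R[n]}) :
  g \is e.-homog ->
  pihomog mdeg (e + d) (g * f) = g * pihomog mdeg d f.
Proof.
(* The bound is at least [msize f], so the components add up to f, and exceeds d, so component d is
   among them. *)
move=> hg; pose k := (msize f + d.+1)%N.
have fE : f = \sum_(i < k) pihomog mdeg i f.
  by apply: pihomog_partitionE; rewrite leq_addr.
have ltdk : (d < k)%N by rewrite /k; lia.
rewrite {1}fE mulr_sumr linear_sum /= (bigD1 (Ordinal ltdk)) //=.
rewrite big1 ?addr0 => [|i ne_id].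
  by rewrite pihomog_dE //; apply: dhomogM => //; apply: pihomogP.
apply: (@pihomog_ne0 _ _ _ (e + i)); last by apply: dhomogM => //; apply: pihomogP.
by rewrite eqn_add2l; apply: contraNneq ne_id => id; apply/eqP/val_inj.
Qed.

Lemma graded_quot (K : fieldType) (n e : nat) (I : set {mpoly K[n]})
    (g : {mpoly K[n]}) :
  g \is e.-homog -> is_graded_ideal I -> is_graded_ideal [set u | I (g * u)].
Proof.
move=> hg [iI hI]; split; first exact: ideal_quot.
by move=> f /= If d; rewrite -(pihomog_mull d f hg); apply: hI.
Qed.

Lemma graded_sub (K : fieldType) (n : nat) (I L : set {mpoly K[n]}) :
  is_graded_ideal I -> is_ideal L ->
  (forall d f, f \is d.-homog -> I f -> L f) -> I `<=` L.
Proof.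
move=> [_ hI] iL IL f If.
have -> : f = \sum_(d < msize f) pihomog mdeg d f by exact: pihomog_partitionE.
by apply: ideal_sum => // i; apply: IL (hI _ If _); apply: pihomogP.
Qed.

Lemma image_scale_quot (R : comNzRingType) (g : R) (I : set R) :
  I `<=` *%R g @` setT -> I = *%R g @` [set u | I (g * u)].
Proof.
move=> Ig; apply/seteqP; split=> [f If|_ [u Iu <-] //].
by have [u _ fE] := Ig f If; exists u; rewrite //= fE.
Qed.

Lemma ideal_mpoly_scale (K : fieldType) (n : nat) (I : set {mpoly K[n]})
    (c : K) (f : {mpoly K[n]}) : is_ideal I -> I f -> I (c *: f).
Proof. by move=> iI If; rewrite -mul_mpolyC; apply: ideal_mulr. Qed.

Lemma ideal_mpoly_unit (K : fieldType) (n : nat) (I : set {mpoly K[n]})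
    (c : K) (f : {mpoly K[n]}) : is_ideal I -> c != 0 -> I (c *: f) -> I f.
Proof.
move=> iI c0 /(ideal_mpoly_scale c^-1 iI).
by rewrite scalerA mulVf // scale1r.
Qed.

Lemma mpolyC_ideal (K : fieldType) (n : nat) (I : set {mpoly K[n]}) (c : K) :
  is_ideal I -> c != 0 -> I c%:MP -> I 1.
Proof. by move=> iI c0; rewrite -[c%:MP]mulr1 mul_mpolyC; apply: ideal_mpoly_unit. Qed.

Lemma mpoly_var0_factor (K : fieldType) (I : set {mpoly K[0]})
    (f : {mpoly K[0]}) :
  is_graded_ideal I -> I f -> f != 0 -> I 1.
Proof.
move=> [iI _] If f0; apply: (@mpolyC_ideal _ _ _ f@_0%MM) => //.
  apply: contraNneq f0 => f0; apply/eqP/mpolyP => m.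
  by rewrite mcoeff0 -f0; congr mcoeff; apply/mnmP => -[].
suff <- : f = (f@_0)%:MP by [].
apply/mpolyP => m; rewrite mcoeffC (_ : m = 0%MM) ?eqxx ?mulr1 //.
by apply/mnmP => -[].
Qed.

Lemma ideal_set0 (R : comNzRingType) : is_ideal [set (0 : R)].
Proof. by split=> // a _ _ -> ->; rewrite mulr0 addr0. Qed.

Lemma graded_homog_neq0 (K : fieldType) (n : nat) (I : set {mpoly K[n]})
    (f : {mpoly K[n]}) :
  is_graded_ideal I -> I f -> f != 0 ->
  exists d h, [/\ h \is d.-homog, I h & h != 0].
Proof.
move=> hI If f0; apply: contrapT => nh; case/eqP: f0.
apply: (graded_sub hI (@ideal_set0 _) _ If) => d h hd Ih /=.
by apply/eqP; apply: contrapT => /negP h0; apply: nh; exists d, h.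
Qed.

Lemma homog_var1 (K : fieldType) (d : nat) (f : {mpoly K[1]}) :
  f \is d.-homog -> exists c, f = c *: 'X_ord0 ^+ d.
Proof.
(* Only x^d can occur in f; summing all coefficients spares a separate case f = 0. *)
move=> /dhomogP hf; exists (\sum_(m <- msupp f) f@_m).
rewrite {1}[f]mpolyE scaler_suml !big_seq; apply: eq_bigr => m /hf md.
have {}md : mdeg m = d := md.
by rewrite mpolyXE_id big_ord1 -md mdegE big_ord1.
Qed.

(** Every nonzero form is a scalar times a power of x, so the least power of x in I divides all the
    others. *)
Lemma mpoly_var1_factor (K : fieldType) (I : set {mpoly K[1]})
    (f : {mpoly K[1]}) :
  is_graded_ideal I -> I f -> f != 0 ->
  exists d, I ('X_ord0 ^+ d) /\ I `<=` *%R ('X_ord0 ^+ d) @` setT.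
Proof.
move=> hI If f0; have [iI _] := hI.
have IX d h : h \is d.-homog -> I h -> h != 0 -> I ('X_ord0 ^+ d).
  move=> /homog_var1[c ->] Ih h0; apply: ideal_mpoly_unit iI _ Ih.
  by apply: contraNneq h0 => ->; rewrite scale0r.
have ex : exists d, `[< I ('X_ord0 ^+ d) >].
  have [d [h [hd Ih h0]]] := graded_homog_neq0 hI If f0.
  by exists d; apply/asboolP; apply: IX h0.
case: (ex_minnP ex) => d /asboolP Id min_d; exists d; split=> //.
apply: graded_sub hI (ideal_scale _ (@ideal_setT _)) _ => e h he Ih.
have [->|h0] := eqVneq h 0; first by exists 0; rewrite ?mulr0.
have le_de : (d <= e)%N by apply/min_d/asboolP; apply: IX h0.
have [c ->] := homog_var1 he; exists (c *: 'X_ord0 ^+ (e - d)) => //.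
by rewrite -scalerAr -exprD subnKC.
Qed.

(** * Forms in two variables and their dehomogenization *)

Lemma mpolyX_var2 (K : fieldType) (m : 'X_{1..2}) :
  'X_[m] = 'X_ord0 ^+ m ord0 * 'X_ord_max ^+ m ord_max :> {mpoly K[2]}.
Proof.
rewrite mpolyXE_id big_ord_recr big_ord1 /=.
by congr ('X__ ^+ m _ * _); apply/val_inj.
Qed.

Lemma mdeg_var2 (m : 'X_{1..2}) : mdeg m = (m ord0 + m ord_max)%N.
Proof.
rewrite mdegE big_ord_recr big_ord1 /=.
by congr (m _ + _)%N; apply/val_inj.
Qed.

Definition dehomog_var (K : fieldType) (i : 'I_2) : {poly K} :=
  if i == ord0 then 'X else 1.

Definition dehomog (K : fieldType) (f : {mpoly K[2]}) : {poly K} :=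
  mmap polyC (@dehomog_var K) f.

(** Inverse to [dehomog] on forms of degree d. Coefficients of p beyond degree d are dropped, whence
    the bounds on [size p] below. *)
Definition homogenize (K : fieldType) (d : nat) (p : {poly K}) : {mpoly K[2]} :=
  \sum_(i < d.+1) p`_i *: ('X_ord0 ^+ i * 'X_ord_max ^+ (d - i)).

Lemma dehomogM (K : fieldType) : {morph @dehomog K : f g / f * g}.
Proof. by move=> f g; rewrite /dehomog rmorphM. Qed.

Lemma dehomogB (K : fieldType) : {morph @dehomog K : f g / f - g}.
Proof. by move=> f g; rewrite /dehomog rmorphB. Qed.

Lemma dehomogZ (K : fieldType) (c : K) (f : {mpoly K[2]}) :
  dehomog (c *: f) = c *: dehomog f.
Proof. by rewrite /dehomog mmapZ mul_polyC. Qed.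

Lemma dehomogXY (K : fieldType) (i j : nat) :
  dehomog ('X_ord0 ^+ i * 'X_ord_max ^+ j) = 'X^i :> {poly K}.
Proof.
by rewrite dehomogM /dehomog !rmorphXn /= !mmapX !mmap1U /dehomog_var /= expr1n mulr1.
Qed.

Lemma dehomogY (K : fieldType) (j : nat) :
  dehomog ('X_ord_max ^+ j) = 1 :> {poly K}.
Proof. by have := dehomogXY K 0 j; rewrite mul1r. Qed.

Lemma dehomogX (K : fieldType) (m : 'X_{1..2}) :
  dehomog 'X_[m] = 'X^(m ord0) :> {poly K}.
Proof. by rewrite (mpolyX_var2 K m) dehomogXY. Qed.

Lemma dehomog_sum (K : fieldType) (T : Type) (r : seq T) (F : T -> {mpoly K[2]}) :
  dehomog (\sum_(i <- r) F i) = \sum_(i <- r) dehomog (F i).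
Proof. by rewrite /dehomog rmorph_sum. Qed.

Lemma homogenizeK (K : fieldType) (d : nat) (p : {poly K}) :
  (size p <= d.+1)%N -> dehomog (homogenize d p) = p.
Proof.
move=> sp; rewrite /homogenize dehomog_sum; under eq_bigr do rewrite dehomogZ dehomogXY.
rewrite -poly_def; apply/polyP => i; rewrite coef_poly.
by case: ltnP => // di; rewrite nth_default // (leq_trans sp).
Qed.

(** Setting y = 1 loses nothing on forms: a monomial of degree d is determined by its exponent in
    x. *)
Lemma dehomogK (K : fieldType) (d : nat) (f : {mpoly K[2]}) :
  f \is d.-homog -> homogenize d (dehomog f) = f.
Proof.
move=> /dhomogP hf; rewrite /homogenize [in RHS](mpolyE f).
under eq_bigr do rewrite [f in dehomog f]mpolyE dehomog_sum coef_sum scaler_suml.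
rewrite exchange_big /= !big_seq; apply: eq_bigr => m /hf md.
have {}md : (m ord0 + m ord_max)%N = d by rewrite -mdeg_var2.
have ltd : (m ord0 < d.+1)%N by lia.
rewrite (bigD1 (Ordinal ltd)) //= big1 ?addr0 => [|i ne].
  rewrite dehomogZ dehomogX coefZ coefXn eqxx mulr1 (mpolyX_var2 K m).
  by have -> : (d - m ord0 = m ord_max)%N by lia.
rewrite dehomogZ dehomogX coefZ coefXn.
rewrite (_ : (i == m ord0 :> nat) = false) ?mulr0 ?scale0r //.
by apply: contraNF ne => /eqP id; apply/eqP/val_inj.
Qed.

Lemma varX_homog (K : fieldType) (n : nat) (i : 'I_n) (d : nat) :
  ('X_i ^+ d : {mpoly K[n]}) \is d.-homog.
Proof.
rewrite -[d in d.-homog]mul1n; apply: dhomogMn.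
by rewrite dhomogX; apply/eqP/mdeg1.
Qed.

Lemma homogenize_homog (K : fieldType) (d : nat) (p : {poly K}) : homogenize d p \is d.-homog.
Proof.
apply: rpred_sum => i _; apply: rpredZ.
have le_id : (i <= d)%N by rewrite -ltnS.
have := dhomogM (varX_homog K (ord0 : 'I_2) i) (varX_homog K ord_max (d - i)).
by rewrite subnKC.
Qed.

Lemma size_dehomog (K : fieldType) (d : nat) (f : {mpoly K[2]}) :
  f \is d.-homog -> (size (dehomog f) <= d.+1)%N.
Proof.
move=> /dhomogP hf; rewrite [f]mpolyE dehomog_sum.
apply: (leq_trans (size_sum _ _ _)); apply/bigmax_leqP_seq => m /hf md _.
have {}md : (m ord0 + m ord_max)%N = d by rewrite -mdeg_var2.
rewrite dehomogZ dehomogX.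
by apply: (leq_trans (size_scale_leq _ _)); rewrite size_polyXn; lia.
Qed.

Lemma homogenizeM (K : fieldType) (d e : nat) (p q : {poly K}) :
  (size p <= d.+1)%N -> (size q <= e.+1)%N ->
  homogenize d p * homogenize e q = homogenize (d + e) (p * q).
Proof.
move=> sp sq; rewrite -[LHS](@dehomogK _ (d + e)).
  by rewrite dehomogM !homogenizeK.
by apply: dhomogM; apply: homogenize_homog.
Qed.

Lemma homogenizeY (K : fieldType) (d : nat) : homogenize d (1 : {poly K}) = 'X_ord_max ^+ d.
Proof.
by rewrite -(dehomogY K d) dehomogK // varX_homog.
Qed.

Lemma dehomog_eq0 (K : fieldType) (d : nat) (f : {mpoly K[2]}) :
  f \is d.-homog -> dehomog f = 0 -> f = 0.
Proof.
move=> hf f0; rewrite -(dehomogK hf) f0 /homogenize.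
by rewrite big1 // => i _; rewrite coef0 scale0r.
Qed.

(* The dehomogenizations of the forms in I make up an ideal of the principal
   ideal domain K[t]. *)
Lemma dehomog_generator (K : fieldType) (I : set {mpoly K[2]})
    (f : {mpoly K[2]}) :
  is_graded_ideal I -> I f -> f != 0 ->
  exists D F, [/\ F \is D.-homog, I F, F != 0 &
    forall d h, h \is d.-homog -> I h -> dehomog F %| dehomog h].
Proof.
(* F is a nonzero form of I whose dehomogenization has the least size. *)
move=> hI If f0; have [iI _] := hI.
pose P s := exists d h, [/\ h \is d.-homog, I h, h != 0 & size (dehomog h) = s].
have ex : exists s, `[< P s >].
  have [d [h [hd Ih h0]]] := graded_homog_neq0 hI If f0.
  by exists (size (dehomog h)); apply/asboolP; exists d, h.
case: (ex_minnP ex) => s /asboolP[D [F [hF IF F0 sF]]] min_s.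
exists D, F; split=> // d h hh Ih; rewrite /dvdp.
set q := dehomog F; set r := dehomog h %% q.
have q0 : q != 0.
  by apply: contraNneq F0 => /(dehomog_eq0 hF) ->.
have [//|r0] := eqVneq r 0.
pose c := dehomog h %/ q; pose e := size c.
(* Division with remainder lifted to forms: the powers of y bring both terms to degree e + d + D,
   and y = 1 turns h' into the remainder r. A nonzero r would contradict the minimality of F. *)
pose h' := 'X_ord_max ^+ (D + e) * h - homogenize e c * 'X_ord_max ^+ d * F.
have hE : dehomog h' = r.
  rewrite /h' dehomogB !dehomogM homogenizeK // !dehomogY mul1r mulr1.
  by rewrite {1}(divp_eq (dehomog h) q) addrC addKr.
have hh' : h' \is (e + d + D).-homog.
  rewrite /h' rpredB //.
    have -> : (e + d + D = D + e + d)%N by lia.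
    by apply: dhomogM => //; apply: varX_homog.
  apply: dhomogM => //; apply: dhomogM; [exact: homogenize_homog|exact: varX_homog].
have Ih' : I h'.
  apply: ideal_add => //; first exact: ideal_mulr.
  by apply: ideal_opp => //; apply: ideal_mulr.
have : (s <= size r)%N.
  apply/min_s/asboolP; exists (e + d + D)%N, h'; split=> //; last by rewrite hE.
  by apply: contraNneq r0 => h0; rewrite -hE h0 /dehomog mmap0.
by rewrite leqNgt -sF ltn_modp q0.
Qed.

(** Here g is the gcd of I up to a power of y: it homogenizes the generator q in its own degree e,
    so F = g y^(D - e), and a quotient of dehomogenized forms lifts to a quotient by g. *)
Lemma mpoly_var2_factorY (K : fieldType) (I : set {mpoly K[2]})
    (f : {mpoly K[2]}) :
  is_graded_ideal I -> I f -> f != 0 ->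
  exists e g E, [/\ g \is e.-homog, g != 0, I (g * 'X_ord_max ^+ E) &
    I `<=` *%R g @` setT].
Proof.
move=> hI If f0; have [iI _] := hI.
have [D [F [hF IF F0 divF]]] := dehomog_generator hI If f0.
set q := dehomog F in divF.
have q0 : q != 0.
  by apply: contraNneq F0 => /(dehomog_eq0 hF) ->.
have sq : (0 < size q)%N by rewrite size_poly_gt0.
have sqD := size_dehomog hF; rewrite -/q in sqD.
pose e := (size q).-1; pose g := homogenize e q.
have gq : dehomog g = q by rewrite homogenizeK // prednK.
exists e, g, (D - e)%N; split.
- exact: homogenize_homog.
- by apply: contraNneq q0 => g0; rewrite -gq g0 /dehomog mmap0.
- rewrite -homogenizeY homogenizeM ?size_poly1 // ?prednK // mulr1 subnKC; last by rewrite /e; lia.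
  by rewrite dehomogK.
apply: graded_sub hI (ideal_scale _ (@ideal_setT _)) _ => d h hh Ih.
have [->|h0] := eqVneq h 0; first by exists 0; rewrite ?mulr0.
have hd0 : dehomog h != 0.
  by apply: contraNneq h0 => /(dehomog_eq0 hh) ->.
have /dvdpP[c hc] := divF _ _ hh Ih.
have c0 : c != 0 by apply: contraNneq hd0; rewrite hc => ->; rewrite mul0r.
have := size_dehomog hh; rewrite hc size_mul // => sd.
have sc : (0 < size c)%N by rewrite size_poly_gt0.
have [le_ed le_cd] : (e <= d /\ size c <= (d - e).+1)%N.
  by move: sd sc sq; rewrite /e; move: (size c) (size q) => m n; lia.
exists (homogenize (d - e) c) => //; rewrite homogenizeM ?prednK // subnKC //.
by rewrite mulrC -hc dehomogK.
Qed.

Lemma homog_var2 (K : fieldType) (d : nat) (f : {mpoly K[2]}) :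
  f \is d.-homog -> exists c g, f = c *: 'X_ord0 ^+ d + 'X_ord_max * g.
Proof.
move=> hf; rewrite -(dehomogK hf) /homogenize big_ord_recr /= subnn mulr1.
exists (dehomog f)`_d.
exists (\sum_(i < d) (dehomog f)`_i *: ('X_ord0 ^+ i * 'X_ord_max ^+ (d - i).-1)).
rewrite addrC mulr_sumr; congr (_ + _); apply: eq_bigr => i _.
rewrite -scalerAr mulrCA -exprS prednK //=.
by rewrite subn_gt0.
Qed.

Lemma ideal_expr_diff (R : comNzRingType) (J : set R) (u v : R) (n : nat) :
  is_ideal J -> J (u - v) -> J (v ^+ n) -> J (u ^+ n).
Proof.
move=> iJ Juv Jv; rewrite -[u ^+ n](subrK (v ^+ n)); apply: ideal_add => //.
by rewrite subrXX; apply: ideal_mull.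
Qed.

Lemma varX_notdvd (K : fieldType) (E : nat) :
  ~ ( *%R ('X_ord_max ^+ E.+1) @` setT) ('X_ord_max ^+ E : {mpoly K[2]}).
Proof.
move=> [w _]; rewrite exprSr -mulrA -[RHS]mulr1.
have y0 : 'X_ord_max ^+ E != 0 :> {mpoly K[2]}.
  by apply: expf_neq0; rewrite -msupp_eq0 msuppX.
move/(mulfI y0)/(congr1 (mcoeff 0%MM)); rewrite rmorphM /= mcoeff1 mcoeffX.
rewrite mnm1_eq0 mul0r eqxx => /eqP; by rewrite eq_sym oner_eq0.
Qed.

(** The factor g of [mpoly_var2_factorY] may miss a common power of y. Once the largest one, y^a, is
    split off too, the quotient J contains a form not divisible by y, and this form yields a power
    of x in J. *)
Lemma mpoly_var2_factor (K : fieldType) (I : set {mpoly K[2]})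
    (f : {mpoly K[2]}) :
  is_graded_ideal I -> I f -> f != 0 ->
  exists g, [/\ g != 0, I `<=` *%R g @` setT &
    exists n, I (g * 'X_ord0 ^+ n) /\ I (g * 'X_ord_max ^+ n)].
Proof.
move=> hI If f0; have [iI _] := hI.
have [e [g [E [hg g0 IE Ig]]]] := mpoly_var2_factorY hI If f0.
set y := 'X_ord_max in IE *; pose J0 := [set u | I (g * u)].
have hJ0 : is_graded_ideal J0 by apply: graded_quot hg hI.
(* Such an a exists because y^E lies in J0 and is not divisible by y^(E+1). *)
have ex : exists a, `[< ~ J0 `<=` *%R (y ^+ a.+1) @` setT >].
  by exists E; apply/asboolP => /(_ (y ^+ E) IE) /varX_notdvd.
case: (ex_minnP ex) => a /asboolP nJa min_a.
have J0a : J0 `<=` *%R (y ^+ a) @` setT.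
  case: a min_a {nJa} => [|a] min_a; first by move=> u _; exists u; rewrite ?mul1r.
  by apply: contrapT => /asboolT /min_a; rewrite ltnn.
pose J := [set u | J0 (y ^+ a * u)].
have hJ : is_graded_ideal J by apply: graded_quot hJ0; apply: varX_homog.
have [iJ _] := hJ.
have JE : J (y ^+ E) by apply: ideal_mulr; first by case: hJ0.
have nJy : ~ J `<=` *%R y @` setT.
  move=> Jy; apply: nJa => u J0u; have [w _ uE] := J0a _ J0u.
  have [|z _ wE] := Jy w; first by rewrite /J /= uE.
  by exists z; rewrite // -uE -wE exprSr mulrA.
have [d [v [hv Jv nv]]] : exists d v, [/\ v \is d.-homog, J v & ~ ( *%R y @` setT) v].
  apply: contrapT => nv; apply: nJy.
  apply: graded_sub hJ (ideal_scale _ (@ideal_setT _)) _ => d v hv Jv.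
  by apply: contrapT => nyv; apply: nv; exists d, v.
have [c [w vE]] := homog_var2 hv.
have c0 : c != 0.
  by apply/eqP => c0; apply: nv; exists w; rewrite // vE c0 scale0r add0r.
(* Modulo v, x^d is a multiple of y, so its E-th power is a multiple of y^E, which lies in J. *)
have Jx : J ('X_ord0 ^+ d ^+ E).
  apply: (@ideal_expr_diff _ _ _ (y * - (c^-1 *: w))) => //; last first.
    by rewrite exprMn; apply: ideal_mull.
  have -> : 'X_ord0 ^+ d - y * - (c^-1 *: w) = c^-1 *: v.
    by rewrite vE scalerDr scalerA mulVf // scale1r mulrN opprK scalerAr.
  exact: ideal_mpoly_scale.
exists (g * y ^+ a); split.
- by apply: mulf_neq0 => //; apply: expf_neq0; rewrite -msupp_eq0 msuppX.
- move=> u Iu; have [w' _ uE] := Ig _ Iu.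
  have [|z _ wE] := J0a w'; first by rewrite /J0 /= uE.
  by exists z; rewrite // -uE -wE mulrA.
- exists (maxn (d * E) E); split; rewrite -mulrA.
    by apply: (@ideal_dvd_pow _ J _ (d * E)); rewrite ?leq_maxl // exprM.
  by apply: (@ideal_dvd_pow _ J _ E); rewrite ?leq_maxr.
Qed.

(** * The homogeneous maximal ideal *)

Definition origin (K : fieldType) (n : nat) : set {mpoly K[n]} :=
  [set f | f@_0%MM = 0].

(** [origin] is the kernel of a ring morphism to the field K, the constant coefficient. *)
Lemma origin_prime (K : fieldType) (n : nat) : is_prime_ideal (@origin K n).
Proof.
split=> [||u v].
- split=> [|a u v]; first exact: mcoeff0.
  by rewrite /origin /= mcoeffD rmorphM => /= -> ->; rewrite mulr0 addr0.
- by rewrite /origin /= rmorph1 => /eqP; rewrite oner_eq0.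
- by rewrite /origin /= rmorphM => /eqP; rewrite mulf_eq0 => /orP[] /eqP; [left|right].
Qed.

(** P contains every nonconstant monomial, hence f minus its constant term for every f; a nonzero
    constant term of a member of P would then put 1 in P. *)
Lemma origin_maximal (K : fieldType) (n : nat) (P : set {mpoly K[n]}) :
  is_ideal P -> ~ P 1 -> (forall i, P 'X_i) -> P = @origin K n.
Proof.
move=> iP P1 PX.
have PXm (m : 'X_{1..n}) : m != 0%MM -> P 'X_[m].
  move=> m0; have [i mi] : exists i, (m i != 0)%N.
    apply: contrapT => nm; case/eqP: m0; apply/mnmP => i; rewrite mnm0E.
    by apply/eqP; apply: contrapT => /negP ne; apply: nm; exists i.
  rewrite -(@submK _ U_(i)%MM m) ?mpolyXD; first exact: ideal_mulr.
  by apply/mnm_lepP => j; rewrite mnm1E; case: eqP => // <-; rewrite lt0n.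
have Pf f : P (f - (f@_0)%:MP).
  (* The constant is absorbed into the sum, so each summand is either 0 or a multiple of a
     nonconstant monomial. *)
  have -> : f - (f@_0)%:MP =
      \sum_(m <- msupp f) (f@_m *: 'X_[m] - (f@_0 * (m == 0%MM)%:R)%:MP).
    rewrite sumrB -mpolyE; congr (_ - _); apply/mpolyP => m'.
    rewrite linear_sum /= !mcoeffC.
    have [fs|nfs] := boolP (0%MM \in msupp f).
      rewrite (bigD1_seq 0%MM) ?msupp_uniq //= big1 => [|i ni].
        by rewrite eqxx mcoeffC mulr1 addr0.
      by rewrite (negbTE ni) mulr0 mcoeffC mul0r.
    by rewrite (memN_msupp_eq0 nfs) mul0r big1 // => i _; rewrite mul0r mcoeffC mul0r.
  apply: ideal_sum => // m; have [->|m0] := eqVneq m 0%MM.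
    rewrite mulr1 mpolyX0 -mul_mpolyC mulr1 subrr; by case: iP.
  by rewrite mulr0 mpolyC0 subr0; apply: ideal_mpoly_scale => //; apply: PXm.
apply/seteqP; split=> f.
  move=> /= Pff; apply/eqP; apply: contrapT => /negP f0; apply: P1.
  apply: mpolyC_ideal f0 _ => //; rewrite -[_%:MP](subKr f).
  by apply: ideal_add => //; apply: ideal_opp.
by move=> /= f0; have := Pf f; rewrite f0 mpolyC0 subr0.
Qed.

Lemma origin_maximal2 (K : fieldType) (P : set {mpoly K[2]}) :
  is_ideal P -> ~ P 1 -> P 'X_ord0 -> P 'X_ord_max -> P = @origin K 2.
Proof.
move=> iP P1 Px Py; apply: origin_maximal => // -[[|[|//]] lti].
  by rewrite (_ : Ordinal lti = ord0) //; apply/val_inj.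
by rewrite (_ : Ordinal lti = ord_max) //; apply/val_inj.
Qed.

(** * Stability of the associated primes *)

Lemma graded_factor (K : fieldType) (n : nat) (I : set {mpoly K[n]})
    (f : {mpoly K[n]}) :
  (n <= 2)%N -> is_graded_ideal I -> I f -> f != 0 ->
  exists g, [/\ g != 0, I `<=` *%R g @` setT & unit_or_primary [set u | I (g * u)]].
Proof.
case: n I f => [|[|[|//]]] I f _ hI If f0.
- exists 1; split; first exact: oner_neq0.
    by move=> u _; exists u; rewrite // mul1r.
  by left; rewrite /= mulr1; apply: mpoly_var0_factor If f0.
- have [d [Id Isub]] := mpoly_var1_factor hI If f0.
  exists ('X_ord0 ^+ d); split=> //; last by left; rewrite /= mulr1.
  by apply: expf_neq0; rewrite -msupp_eq0 msuppX.
- have [g [g0 Isub [m [Ix Iy]]]] := mpoly_var2_factor hI If f0.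
  exists g; split=> //; right; exists (@origin K 2), 'X_ord0, 'X_ord_max, m.
  by split=> //; [exact: origin_prime|exact: origin_maximal2].
Qed.

Lemma Ass_exp_graded (K : fieldType) (n : nat) (I : set {mpoly K[n]}) (k : nat) :
  (n <= 2)%N -> is_graded_ideal I -> (0 < k)%N -> Ass (ideal_exp I k) = Ass I.
Proof.
move=> n2 hI k0; have [iI _] := hI.
have [[f [If f0]]|nf] := pselect (exists f, I f /\ f != 0).
  have [g [g0 Isub cJ]] := graded_factor n2 hI If f0.
  by rewrite (image_scale_quot Isub); apply: Ass_exp_scale => //; apply: ideal_quot.
(* Here I = 0, which equals all its positive powers. *)
congr Ass; apply/seteqP; split; first exact: ideal_exp_sub.
move=> f If; suff -> : f = 0 by case: (ideal_exp_ideal I k).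
by apply/eqP; apply: contrapT => /negP f0; apply: nf; exists f.
Qed.

Lemma graded_astab1 (K : fieldType) (n : nat) (I : set {mpoly K[n]}) :
  (n <= 2)%N -> is_graded_ideal I -> is_astab I 1.
Proof.
move=> n2 hI; split=> [|k []//]; split=> // k k0.
by rewrite !Ass_exp_graded.
Qed.

(** * The ideals (x^(2b+1), x^2 y^(2b-1), y^(2b+1)) *)

(* x^a y^c is divisible by the product of i, j and l factors equal to the
   generators x^(2b+1), x^2 y^(2b-1) and y^(2b+1) respectively. *)
Definition in_power (b k a c : nat) : Prop :=
  exists i j l, [/\ (i + j + l = k)%N, ((2 * b + 1) * i + 2 * j <= a)%N &
    ((2 * b - 1) * j + (2 * b + 1) * l <= c)%N].

(** All three generators have degree 2b + 1; b > 0 keeps the truncated subtraction 2b - 1 exact. *)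
Lemma in_power_weight (b i j l : nat) : (0 < b)%N ->
  ((2 * b + 1) * i + 2 * j + ((2 * b - 1) * j + (2 * b + 1) * l) =
   (2 * b + 1) * (i + j + l))%N.
Proof. by case: b => // b _; rewrite (_ : 2 * b.+1 - 1 = 2 * b + 1)%N; [ring|lia]. Qed.

Lemma in_power_degree (b k a c : nat) :
  (0 < b)%N -> in_power b k a c -> ((2 * b + 1) * k <= a + c)%N.
Proof.
move=> b0 [i [j [l [<- ia lc]]]].
by rewrite -(in_power_weight i j l b0) leq_add.
Qed.

Lemma in_power_leq (b k a c a' c' : nat) :
  (a <= a')%N -> (c <= c')%N -> in_power b k a c -> in_power b k a' c'.
Proof.
move=> aa cc [i [j [l [e ia lc]]]]; exists i, j, l.
by split; [|apply: leq_trans aa|apply: leq_trans cc].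
Qed.

Lemma in_powerD (b k k' a c a' c' : nat) :
  in_power b k a c -> in_power b k' a' c' -> in_power b (k + k') (a + a') (c + c').
Proof.
move=> [i [j [l [<- ia lc]]]] [i' [j' [l' [<- ia' lc']]]].
exists (i + i')%N, (j + j')%N, (l + l')%N; rewrite !mulnDr; split; [ring|lia|lia].
Qed.

(** The class of x^a y^c is a nonzero socle element of S/I^k. *)
Definition socle_exponent (b k a c : nat) : Prop :=
  [/\ ~ in_power b k a c, in_power b k a.+1 c & in_power b k a c.+1].

Lemma socle_degree_ge (b k a c : nat) :
  (0 < b)%N -> socle_exponent b k a c -> ((2 * b + 1) * k - 1 <= a + c)%N.
Proof. by move=> b0 [_ /(in_power_degree b0) ka _]; lia. Qed.

(** Otherwise a + c = (2b+1)k - 1, so x^(a+1) y^c and x^a y^(c+1) have the degree of the generators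
    of I^k and are themselves products of k generators. Both a + 1 and a are then of the form
    (2b+1)i + 2j with j <= k < b. *)
Lemma socle_degree_ge_small (b k a c : nat) :
  (k < b)%N -> socle_exponent b k a c -> ((2 * b + 1) * k <= a + c)%N.
Proof.
move=> kb sac; have b0 : (0 < b)%N by lia.
have := socle_degree_ge b0 sac; case: sac => _.
move=> [i [j [l [e ia lc]]]] [i' [j' [l' [e' ia' lc']]]] ge.
have := in_power_weight i j l b0; have := in_power_weight i' j' l' b0.
rewrite e e'; rewrite leqNgt; set D := ((2 * b + 1) * k)%N in ge * => w' w.
apply/negP => lt.
have x : ((2 * b + 1) * i + 2 * j = a.+1)%N by lia.
have x' : ((2 * b + 1) * i' + 2 * j' = a)%N by lia.
(* If i and i' differ, the gap of at least 2b + 1 must be made up, to within 1, by the terms 2j and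
   2j', which forces j or j' to be at least b. If they agree, parity fails. *)
have [lt_i|lt_i|eq_i] := ltngtP i i'.
- have : ((2 * b + 1) * i.+1 <= (2 * b + 1) * i')%N by rewrite leq_mul2l lt_i orbT.
  by rewrite mulnS; lia.
- have : ((2 * b + 1) * i'.+1 <= (2 * b + 1) * i)%N by rewrite leq_mul2l lt_i orbT.
  by rewrite mulnS; lia.
- by move: x x'; rewrite eq_i; lia.
Qed.

(** With exponent 1 in x only powers of y^(2b+1) can be used, and y^((2b+1)k - 1) falls one short.
    Another factor x makes x^2 y^(2b-1) available. *)
Lemma socle_exponent_gen (b k : nat) : (0 < b)%N -> (0 < k)%N ->
  socle_exponent b k 1 ((2 * b + 1) * k).-1.
Proof.
case: k => // k b0 _; rewrite mulnS; split.
- move=> [i [j [l [e ia lc]]]].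
  have [i0 j0] : i = 0%N /\ j = 0%N by case: i e ia => [|i] e; nia.
  have lE : l = k.+1 by lia.
  by move: lc; rewrite lE mulnS; lia.
- by exists 0%N, 1%N, k; split; lia.
- by exists 0%N, 0%N, k.+1; rewrite mulnS; split; lia.
Qed.

(** The degree is one too small for I^k. Raising x gives x^(2b+1) times k - 1 factors y^(2b+1);
    raising y gives b factors x^2 y^(2b-1) and k - b factors y^(2b+1), which is where b <= k
    enters. *)
Lemma socle_exponent_large (b k : nat) : (0 < b)%N -> (b <= k)%N ->
  socle_exponent b k (2 * b) ((2 * b + 1) * k - 1 - 2 * b).
Proof.
move=> b0 bk; have kE : k = (b + (k - b))%N by rewrite subnKC.
have k1 : ((2 * b + 1) * k = 2 * b + 1 + (2 * b + 1) * k.-1)%N.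
  by rewrite -[in LHS](@prednK k) ?mulnS //; lia.
have ge : (2 * b + 1 <= (2 * b + 1) * k)%N by rewrite k1 leq_addr.
have w : (2 * b + ((2 * b - 1) * b + (2 * b + 1) * (k - b)) = (2 * b + 1) * k)%N.
  by have := in_power_weight 0 b (k - b) b0; rewrite add0n -kE muln0.
split.
- by move/(in_power_degree b0); move: (_ * k)%N ge => D; lia.
- exists 1%N, 0%N, k.-1; split; [lia|lia|].
  by rewrite k1; move: (_ * k.-1)%N => v; lia.
- exists 0%N, b, (k - b)%N; split; [lia|lia|].
  by move: w ge; move: (_ + _ * (k - b))%N (_ * k)%N => u D; lia.
Qed.

(** * Powers of the family as monomial ideals *)

Definition family_ideal (K : fieldType) (b : nat) : set {mpoly K[2]} :=
  ideal_gen [set 'X_ord0 ^+ (2 * b + 1);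
                 'X_ord0 ^+ 2 * 'X_ord_max ^+ (2 * b - 1);
                 'X_ord_max ^+ (2 * b + 1)].

Lemma msupp_XY (K : fieldType) (a c : nat) (m : 'X_{1..2}) :
  m \in msupp ('X_ord0 ^+ a * 'X_ord_max ^+ c : {mpoly K[2]}) ->
  m ord0 = a /\ m ord_max = c.
Proof.
rewrite !mpolyXn -mpolyXD msuppX mem_seq1 => /eqP ->.
by rewrite !mnmDE !mulmnE !mnm1E /= !mul0n !mul1n addn0.
Qed.

Lemma XY_msupp (K : fieldType) (a c : nat) :
  exists2 m : 'X_{1..2}, m \in msupp ('X_ord0 ^+ a * 'X_ord_max ^+ c : {mpoly K[2]}) &
    m ord0 = a /\ m ord_max = c.
Proof.
exists (U_(ord0) *+ a + U_(ord_max) *+ c)%MM.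
  by rewrite !mpolyXn -mpolyXD msuppX mem_seq1.
by rewrite !mnmDE !mulmnE !mnm1E /= !mul0n !mul1n addn0.
Qed.

Lemma XY_homog (K : fieldType) (a c : nat) :
  ('X_ord0 ^+ a * 'X_ord_max ^+ c : {mpoly K[2]}) \is (a + c).-homog.
Proof. by apply: dhomogM; apply: varX_homog. Qed.

(** The monomial ideal that [family_exp] identifies with I^k, encoded by supports: f belongs to it
    exactly when all its monomials do. *)
Definition in_power_set (K : fieldType) (b k : nat) : set {mpoly K[2]} :=
  [set f | forall m, m \in msupp f -> in_power b k (m ord0) (m ord_max)].

Lemma in_power_set_mul (K : fieldType) (b i j : nat) (u v : {mpoly K[2]}) :
  in_power_set b i u -> in_power_set b j v -> in_power_set b (i + j) (u * v).
Proof.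
move=> Tu Tv m /msuppM_le/allpairsP[[m1 m2] [/= /Tu T1 /Tv T2 ->]].
by rewrite !mnmDE; apply: in_powerD.
Qed.

Lemma in_power_set_ideal (K : fieldType) (b k : nat) : is_ideal (@in_power_set K b k).
Proof.
split=> [m|a u v Tu Tv m]; first by rewrite msupp0.
move/msuppD_le; rewrite mem_cat => /orP[|]; last exact: Tv.
move/msuppM_le/allpairsP=> [[m1 m2] [/= _ /Tu T2 ->]].
by rewrite !mnmDE; apply: in_power_leq T2; rewrite leq_addl.
Qed.

Lemma family_ideal_sub (K : fieldType) (b : nat) :
  @family_ideal K b `<=` in_power_set b 1.
Proof.
apply: smallest_sub; first exact: in_power_set_ideal.
move=> _ [[->|->]|->] m.
- rewrite -[_ ^+ _](mulr1 _) -(expr0 'X_ord_max) => /msupp_XY[-> ->].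
  by exists 1%N, 0%N, 0%N; split; lia.
- by move/msupp_XY=> [-> ->]; exists 0%N, 1%N, 0%N; split; lia.
- rewrite -[_ ^+ _](mul1r _) -(expr0 'X_ord0) => /msupp_XY[-> ->].
  by exists 0%N, 0%N, 1%N; split; lia.
Qed.

Lemma mem_family_exp (K : fieldType) (b k a c : nat) :
  in_power b k a c ->
  ideal_exp (@family_ideal K b) k ('X_ord0 ^+ a * 'X_ord_max ^+ c).
Proof.
move=> [i [j [l [<- ia lc]]]].
have genI u : [set 'X_ord0 ^+ (2 * b + 1); 'X_ord0 ^+ 2 * 'X_ord_max ^+ (2 * b - 1);
    'X_ord_max ^+ (2 * b + 1)] u -> @family_ideal K b u by apply: sub_gen_smallest.
have Ii : @family_ideal K b ('X_ord0 ^+ (2 * b + 1)) by apply: genI; left; left.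
have Ij : @family_ideal K b ('X_ord0 ^+ 2 * 'X_ord_max ^+ (2 * b - 1)).
  by apply: genI; left; right.
have Il : @family_ideal K b ('X_ord_max ^+ (2 * b + 1)) by apply: genI; right.
have := ideal_expD (ideal_expD (ideal_exp_expr i Ii) (ideal_exp_expr j Ij))
  (ideal_exp_expr l Il).
set g := (_ * _ * _) => Ig.
(* The cofactor collects the exponents in excess of the product g of generators. *)
suff -> : 'X_ord0 ^+ a * 'X_ord_max ^+ c =
    'X_ord0 ^+ (a - ((2 * b + 1) * i + 2 * j)) *
    'X_ord_max ^+ (c - ((2 * b - 1) * j + (2 * b + 1) * l)) * g.
  by apply: ideal_mulr => //; apply: ideal_exp_ideal.
rewrite -{1}(subnK ia) -{1}(subnK lc) /g exprMn -!exprM [LHS]/= !(exprD _ (_ - _)).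
rewrite (exprD _ (_ * i)) (exprD _ (_ * j)); ring.
Qed.

Lemma family_exp (K : fieldType) (b k : nat) :
  ideal_exp (@family_ideal K b) k = in_power_set b k.
Proof.
apply/seteqP; split.
  elim: k => [|k IHk].
    by move=> f _ m _; exists 0%N, 0%N, 0%N; rewrite !muln0.
  apply: (@ideal_mul_sub _ _ (ideal_exp (@family_ideal K b) k)).
    exact: in_power_set_ideal.
  move=> u v /family_ideal_sub Tu /IHk Tv; exact: (in_power_set_mul Tu Tv).
move=> f Tf; rewrite [f]mpolyE big_seq.
apply: (big_ind (ideal_exp (family_ideal b) k)) => [|u v|m /Tf Tm].
- by case: (ideal_exp_ideal (@family_ideal K b) k).
- by apply: ideal_add; apply: ideal_exp_ideal.
- apply: ideal_mpoly_scale; first exact: ideal_exp_ideal.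
  by rewrite mpolyX_var2; apply: mem_family_exp.
Qed.

(** Membership depends only on the support, and passing to a homogeneous component shrinks the
    support. *)
Lemma family_graded (K : fieldType) (b : nat) : is_graded_ideal (@family_ideal K b).
Proof.
have iI : is_ideal (@family_ideal K b) by apply: ideal_gen_ideal.
split=> // f; rewrite -(ideal_exp1 iI) family_exp => Tf d m.
rewrite mcoeff_msupp mcoeff_pihomog; case: ifP => [_|]; last by rewrite eqxx.
by rewrite -mcoeff_msupp; apply: Tf.
Qed.

Lemma mem_XY (K : fieldType) (b k a c : nat) :
  in_power_set b k ('X_ord0 ^+ a * 'X_ord_max ^+ c : {mpoly K[2]}) <-> in_power b k a c.
Proof.
split=> [Tac|ac m /msupp_XY[-> ->] //].
by have [m /Tac + [<- <-]] := XY_msupp K a c.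
Qed.

(** * Associated primes and v-numbers of the powers *)

Lemma Ass_family_exp (K : fieldType) (b k : nat) (P : set {mpoly K[2]}) :
  Ass (ideal_exp (@family_ideal K b) k) P -> P = @origin K 2.
Proof.
move=> AP; have [pP _] := AP; have [iP P1 _] := pP.
have IP := Ass_sub (ideal_exp_ideal _ _) AP; rewrite family_exp in IP.
(* I^k contains x^((2b+1)k) and y^((2b+1)k), so P contains both variables. *)
apply: origin_maximal2 => //;
  apply: (@prime_expr _ _ _ ((2 * b + 1) * k) pP); apply: IP.
  rewrite -[_ ^+ _](mulr1 _) -(expr0 'X_ord_max); apply/mem_XY.
  by exists k, 0%N, 0%N; split; lia.
rewrite -[_ ^+ _](mul1r _) -(expr0 'X_ord0); apply/mem_XY.
by exists 0%N, 0%N, k; split; lia.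
Qed.

Lemma colon_XY (K : fieldType) (b k a c : nat) :
  socle_exponent b k a c ->
  colon (ideal_exp (@family_ideal K b) k) ('X_ord0 ^+ a * 'X_ord_max ^+ c) =
  @origin K 2.
Proof.
move=> [nac Sa Sc]; apply: origin_maximal2; rewrite /colon /= ?family_exp.
- by apply: colon_ideal; apply: in_power_set_ideal.
- by rewrite mul1r => /mem_XY.
- by rewrite mulrA -exprS; apply/mem_XY.
- by rewrite mulrCA -exprS; apply/mem_XY.
Qed.

(** A form can be replaced by one of its monomials: some monomial m of f is outside I^k, while x f
    and y f, hence their monomials x m and y m, are in the monomial ideal I^k. *)
Lemma socle_of_colon (K : fieldType) (b k d : nat) (f : {mpoly K[2]}) :
  f \is d.-homog -> colon (ideal_exp (@family_ideal K b) k) f = @origin K 2 ->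
  exists a c, socle_exponent b k a c /\ (a + c = d)%N.
Proof.
rewrite family_exp => /dhomogP hf fM.
have nTf : ~ in_power_set b k f.
  move=> Tf; have [_ + _] := origin_prime K 2; apply.
  by rewrite -fM /colon /= mul1r.
have [m /not_implyP[mf nm]] :
    exists m, ~ (m \in msupp f -> in_power b k (m ord0) (m ord_max)).
  exact/existsNP.
have Xm i : in_power b k ((m + U_(i))%MM ord0) ((m + U_(i))%MM ord_max).
  have : colon (in_power_set b k) f 'X_i.
    by rewrite fM /origin /= mcoeffX mnm1_eq0.
  (* The coefficient of x_i f at x_i m is that of f at m, so no cancellation occurs. *)
  by apply; rewrite mcoeff_msupp (mulrC 'X_i) addmC mcoeffMX -mcoeff_msupp.
exists (m ord0), (m ord_max); split; last first.
  by have md : mdeg m = d := hf m mf; rewrite -mdeg_var2.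
split=> //.
  by have := Xm ord0; rewrite !mnmDE !mnm1E /= addn0 addn1.
by have := Xm ord_max; rewrite !mnmDE !mnm1E /= addn0 addn1.
Qed.

(** As (x, y) is the only possible associated prime, the outer minimum runs over a single prime. *)
Lemma family_vnumber (K : fieldType) (b k a c : nat) :
  socle_exponent b k a c ->
  (forall a' c', socle_exponent b k a' c' -> (a + c <= a' + c')%N) ->
  is_vnumber (ideal_exp (@family_ideal K b) k) (a + c).
Proof.
move=> sac min_ac.
have vM : is_vnumber_at (ideal_exp (@family_ideal K b) k) (@origin K 2) (a + c).
  split=> [|d [f hf /(socle_of_colon hf)[a' [c' [s <-]]]]]; last exact: min_ac.
  by exists ('X_ord0 ^+ a * 'X_ord_max ^+ c); [exact: XY_homog|exact: colon_XY].
split=> [|d [P /Ass_family_exp -> [[f hf fM] _]]].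
  exists (@origin K 2) => //; split; first exact: origin_prime.
  by exists ('X_ord0 ^+ a * 'X_ord_max ^+ c); apply: colon_XY.
by case: vM => _; apply; exists f.
Qed.

Lemma family_vnumber_small (K : fieldType) (b k : nat) :
  (0 < k < b)%N -> is_vnumber (ideal_exp (@family_ideal K b) k) ((2 * b + 1) * k).
Proof.
move=> /andP[k0 kb]; have b0 : (0 < b)%N by lia.
have kE : (1 + ((2 * b + 1) * k).-1 = (2 * b + 1) * k)%N.
  by rewrite add1n prednK // muln_gt0 addn1.
rewrite -kE; apply: family_vnumber; first exact: socle_exponent_gen.
by move=> a c /(socle_degree_ge_small kb); rewrite kE.
Qed.

Lemma family_vnumber_large (K : fieldType) (b k : nat) :
  (0 < b <= k)%N ->
  is_vnumber (ideal_exp (@family_ideal K b) k) ((2 * b + 1) * k - 1).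
Proof.
move=> /andP[b0 bk].
have kE : (2 * b + ((2 * b + 1) * k - 1 - 2 * b) = (2 * b + 1) * k - 1)%N.
  have : (2 * b + 1 <= (2 * b + 1) * k)%N by rewrite leq_pmulr //; lia.
  by move: (_ * k)%N => D; lia.
rewrite -kE; apply: family_vnumber; first exact: socle_exponent_large.
by move=> a c /(socle_degree_ge b0); rewrite kE.
Qed.

Lemma family_initial_degree (K : fieldType) (b : nat) :
  (0 < b)%N -> is_initial_degree (@family_ideal K b) (2 * b + 1).
Proof.
move=> b0; split=> [|d [f [If hf f0]]].
  exists ('X_ord0 ^+ (2 * b + 1)); split; first by apply: sub_gen_smallest; left; left.
    exact: varX_homog.
  by apply: expf_neq0; rewrite -msupp_eq0 msuppX.
have := If; move/family_ideal_sub => Tf.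
case E : (msupp f) => [|m s]; first by move: f0; rewrite -msupp_eq0 E.
have mf : m \in msupp f by rewrite E mem_head.
have md : mdeg m = d := dhomog_mf hf mf.
by have := in_power_degree b0 (Tf m mf); rewrite -mdeg_var2 md muln1.
Qed.

Lemma is_least_uniq (P : set nat) (m n : nat) : is_least P m -> is_least P n -> m = n.
Proof.
move=> [Pm mP] [Pn nP]; apply/eqP; rewrite eqn_leq; apply/andP.
by split; [apply: mP|apply: nP].
Qed.

Lemma family_vstab (K : fieldType) (b : nat) :
  (0 < b)%N -> is_vstab (@family_ideal K b) b.
Proof.
move=> b0; exists (2 * b + 1)%N, (-1); split; first exact: family_initial_degree.
split=> [|j [j0 linj]].
  split=> // k bk; exists ((2 * b + 1) * k - 1)%N.
    by apply: family_vnumber_large; rewrite b0.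
  have : (0 < (2 * b + 1) * k)%N by rewrite muln_gt0; lia.
  by rewrite -PoszM; move: (_ * k)%N => D; lia.
(* For j < b the v-number is (2b+1)j, one above the line with constant -1. *)
rewrite leqNgt; apply/negP => jb; have [m vm] := linj j (leqnn j).
have -> := is_least_uniq vm (family_vnumber_small K (_ : 0 < j < b)%N).
  by rewrite -PoszM; move: (_ * j)%N => D; lia.
by rewrite jb andbT.
Qed.

Theorem theorem1p1 (K : fieldType) :
  (forall (n : nat), (n <= 2)%N ->
     forall I : set {mpoly K[n]}, is_graded_ideal I -> is_astab I 1%N) /\
  (forall b : nat, (1 <= b)%N ->
     let x : {mpoly K[2]} := 'X_ord0 in
     let y : {mpoly K[2]} := 'X_ord_max in
     let I : set {mpoly K[2]} :=
       ideal_gen [set x ^+ (2 * b + 1); x ^+ 2 * y ^+ (2 * b - 1);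
                      y ^+ (2 * b + 1)] in
     [/\ forall k : nat, (1 <= k <= b - 1)%N ->
           is_vnumber (ideal_exp I k) ((2 * b + 1) * k)%N,
         forall k : nat, (b <= k)%N ->
           is_vnumber (ideal_exp I k) ((2 * b + 1) * k - 1)%N,
         is_astab I 1%N
       & is_vstab I b]).
Proof.
split=> [n n2 I hI|b b0 x y I]; first exact: graded_astab1.
split=> [k kb|k bk||].
- by apply: (@family_vnumber_small K b k); lia.
- by apply: (@family_vnumber_large K b k); rewrite b0.
- by apply: graded_astab1 => //; apply: family_graded.
- exact: family_vstab.
Qed.
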